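(* Fix a labeling of the infinite rooted binary tree $T_\infty$ with root $x_0$, an integer $\ell\geq2$ and an integer $n\geq0$. Define $\psi_n:M_{\ell,n}\to\{\pm1\}^n$ by $\psi_n(\sigma)=(e_1,\dots,e_n)$, where $e_i=\operatorname{sgn}_i(\sigma,x_0)$ if $1\le i\le\ell-1$; $e_i=+1$ if $i\geq\ell$ and $\sigma$ is an $(\ell,i)$-even cousins map above $x_0$; and $e_i=-1$ if $i\ge\ell$ and $\sigma$ is an $(\ell,i)$-odd cousins map above $x_0$. Then $\psi_n$ is a surjective group homomorphism and $\ker\psi_n$ is the commutator subgroup of $M_{\ell,n}$. In particular, the abelianization of $M_{\ell,n}$ is isomorphic to $\{\pm1\}^n$.
   Context: $T_n$ is the subtree of levels $0,\dots,n$. A labeling assigns to each node at level $m$ a word in $\{0,1\}^m$, bijectively per level, with children of $w$ labeled $w0,w1$. For a tree automorphism $\sigma$, node $y$, $m\geq1$: $\sigma$ sends the node $ys_1\dots s_m$ to $\sigma(y)t_1\dots t_m$, and $\operatorname{sgn}_m(\sigma,y)$ is the sign of the permutation $(s_i)\mapsto(t_i)$ of $\{0,1\}^m$. $M_\ell$ is the set of $\sigma\in\operatorname{Aut}(T_\infty)$ with $\operatorname{sgn}_\ell(\sigma,y)=+1$ for every node $y$, and $M_{\ell,n}$ is the group of restrictions of elements of $M_\ell$ to $T_n$. For $\sigma\in M_{\ell,n}$ and a node $w$ with children $y_0,y_1$, $\sigma$ acts $\ell$-negatively above $w$ if $\operatorname{sgn}_{\ell-1}(\sigma,y_0)=\operatorname{sgn}_{\ell-1}(\sigma,y_1)=-1$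 (these two signs are always equal for such $\sigma$). For $\ell\le i\le n$ and a node $x$, $\sigma$ is an $(\ell,i)$-odd cousins map above $x$ if the number of nodes $w$ lying $i-\ell$ levels above $x$ above which $\sigma$ acts $\ell$-negatively is odd, and an $(\ell,i)$-even cousins map otherwise. *)

(* Defs.v *)
From HB Require Import structures.
From mathcomp Require Import all_boot all_fingroup all_algebra.
From mathcomp Require Import boolp.

Set Implicit Arguments.
Unset Strict Implicit.
Unset Printing Implicit Defensive.

Import GRing.Theory.

(* The group {1, -1}, as a subset of the integers under multiplication. *)

Definition pm1 : Type := seq_sub [:: 1%R; -1 : int]%R.

HB.instance Definition _ := Finite.on pm1.

Lemma pm1_sign_subproof (b : bool) :
  ((-1) ^+ b)%R \in [:: 1%R; -1 : int]%R.
Proof. by case: b. Qed.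

Definition pm1_sign (b : bool) : pm1 := SeqSub (pm1_sign_subproof b).

Lemma pm1_mul_subproof (x y : pm1) :
  (val x * val y)%R \in [:: 1%R; -1 : int]%R.
Proof. by case: x y => [x +] [y +] /=; rewrite !inE => /orP[] /eqP-> /orP[] /eqP->. Qed.

Definition pm1_mul (x y : pm1) : pm1 := SeqSub (pm1_mul_subproof x y).

Lemma pm1_mulA : associative pm1_mul.
Proof. by move=> x y z; apply: val_inj; rewrite /= mulrA. Qed.

Lemma pm1_mul1 : left_id (pm1_sign false) pm1_mul.
Proof. by move=> x; apply: val_inj; rewrite /= mul1r. Qed.

Lemma pm1_mulV : left_inverse (pm1_sign false) id pm1_mul.
Proof.
move=> x; apply: val_inj => /=.
by case: x => /= x; rewrite !inE => /orP[] /eqP->.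
Qed.

HB.instance Definition _ := Finite_isGroup.Build pm1 pm1_mulA pm1_mul1 pm1_mulV.

Lemma pm1_sign0 : pm1_sign false = 1%g.
Proof. by []. Qed.

Lemma pm1_signM b c : pm1_sign (b (+) c) = (pm1_sign b * pm1_sign c)%g.
Proof. by apply: val_inj; case: b c => [] []. Qed.

(* The infinite rooted binary tree: the root is the empty sequence, the
   children of x are rcons x false and rcons x true, the level of x is its
   size, and the nodes above x are the x ++ v. This model only carries the tree
   structure: words enter through an arbitrary labeling (below). The tree of
   levels 0, ..., n is the finite type n.-bseq bool. *)
Definition node : Type := seq bool.

Definition root : node := [::].

Definition is_child (x y : node) : bool :=
  (y == rcons x false) || (y == rcons x true).

Definition is_tree_aut (f : node -> node) : Prop :=
  [/\ bijective f, f root = root &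
      forall x y, is_child (f x) (f y) = is_child x y].

Record labeling := Labeling {
  label : node -> seq bool;
  node_of : seq bool -> node;
  labelK : cancel label node_of;
  node_ofK : cancel node_of label;
  size_label : forall x, size (label x) = size x;
  label_children : forall x,
    perm_eq [:: label (rcons x false); label (rcons x true)]
            [:: rcons (label x) false; rcons (label x) true] }.

Section Sign.

Variable L : labeling.
Implicit Types (f g : node -> node) (x y w : node).

(* The word t_1 ... t_m such that f sends the node labeled y s_1 ... s_m to the
   node labeled f(y) t_1 ... t_m; see label_actP. *)
Definition label_act f y m (s : m.-tuple bool) : m.-tuple bool :=
  insubd s (drop (size y) (label L (f (node_of L (label L y ++ s))))).

(* The default value of insubd is never used for a tree automorphism, nor for
   the restriction of one to the levels 0, ..., n when size y + m <= n;
   see label_permE. *)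
Definition label_perm f y m : {perm m.-tuple bool} :=
  insubd (1%g : {perm m.-tuple bool}) [ffun s => label_act f y s].

Definition sgn m f y : pm1 := pm1_sign (odd_perm (label_perm f y m)).

Definition in_M l f : Prop :=
  is_tree_aut f /\ forall y, sgn l f y = pm1_sign false.

Definition acts_negatively l f w : bool :=
  (sgn l.-1 f (rcons w false) == pm1_sign true) &&
  (sgn l.-1 f (rcons w true) == pm1_sign true).

Definition odd_cousins l i f x : bool :=
  odd #|[set v : (i - l).-tuple bool | acts_negatively l f (x ++ v)]|.

Definition restricts n f (s : {perm n.-bseq bool}) : Prop :=
  forall x : n.-bseq bool, s x = f x :> node.

Definition M_set l n : {set {perm n.-bseq bool}} :=
  [set s | `[< exists f, in_M l f /\ restricts f s >]].

(* A permutation of the nodes of level at most n, as a function on all nodes;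
   the values at levels above n are irrelevant. *)
Definition extend n (s : {perm n.-bseq bool}) : node -> node :=
  fun x => if insub x is Some x' then s x' : seq bool else x.

(* The coordinates e_1, ..., e_n are indexed from 0: e_(i+1) is at i : 'I_n. *)
Definition psi l n (s : {perm n.-bseq bool}) : {dffun forall i : 'I_n, pm1} :=
  [ffun i : 'I_n =>
     if i.+1 < l then sgn i.+1 (extend s) root
     else pm1_sign (odd_cousins l i.+1 (extend s) root)].

Definition steps (g : seq bool -> seq bool) :=
  forall x b, exists c, g (rcons x b) = rcons (g x) c.

Lemma steps_cat g : steps g ->
  forall x v, exists2 v', size v' = size v & g (x ++ v) = g x ++ v'.
Proof.
move=> gP x; elim/last_ind => [|v b [v' sv' IH]]; first by exists [::]; rewrite ?cats0.
have [c E] := gP (x ++ v) b.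
by exists (rcons v' c); rewrite ?size_rcons ?sv' // -!rcons_cat E IH rcons_cat.
Qed.

Lemma steps_comp g h : steps g -> steps h -> steps (g \o h).
Proof.
by move=> gP hP x b /=; have [c ->] := hP x b; have [d ->] := gP (h x) c; exists d.
Qed.

Lemma steps_label : steps (label L).
Proof.
move=> x b; have := perm_mem (label_children L x) (label L (rcons x b)).
have -> : label L (rcons x b) \in
    [:: label L (rcons x false); label L (rcons x true)].
  by case: b; rewrite !inE eqxx ?orbT.
by rewrite !inE => /esym/orP[] /eqP->; [exists false | exists true].
Qed.

Lemma steps_node_of : steps (node_of L).
Proof.
move=> w c; have := perm_mem (label_children L (node_of L w)) (rcons w c).
rewrite node_ofK.
have -> : rcons w c \in [:: rcons w false; rcons w true].
  by case: c; rewrite !inE eqxx ?orbT.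
rewrite !inE => /orP[] /eqP->; rewrite labelK; [by exists false | by exists true].
Qed.

Lemma steps_aut f : is_tree_aut f -> steps f.
Proof.
move=> [_ _ fP] x b; have := fP x (rcons x b).
have -> : is_child x (rcons x b) by case: b; rewrite /is_child eqxx ?orbT.
by case/orP => /eqP->; [exists false | exists true].
Qed.

Lemma size_aut f : is_tree_aut f -> forall x, size (f x) = size x.
Proof.
move=> fA x; have [v' sv'] := steps_cat (steps_aut fA) root x.
by case: fA => _ -> _ /= ->.
Qed.

Lemma label_actP f y m (s : m.-tuple bool) : is_tree_aut f ->
  label L (f (node_of L (label L y ++ s))) = label L (f y) ++ label_act f y s.
Proof.
move=> fA.
have gP := steps_comp (steps_comp steps_label (steps_aut fA)) steps_node_of.
have [t st] := steps_cat gP (label L y) s.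
rewrite /label_act /= labelK => ->.
rewrite drop_size_cat ?size_label ?size_aut // insubdK //.
by rewrite unfold_in /= st size_tuple eqxx.
Qed.

Lemma label_act_inj f y m : is_tree_aut f -> injective (@label_act f y m).
Proof.
move=> fA s t E; apply: val_inj.
have : label L (f (node_of L (label L y ++ s))) =
       label L (f (node_of L (label L y ++ t))) by rewrite !label_actP // E.
move/(can_inj (labelK L)); case: fA => /bij_inj fI _ _ /fI.
by move/(can_inj (node_ofK L))/eqP; rewrite eqseq_cat // eqxx => /eqP.
Qed.

Lemma label_permE f y m (s : m.-tuple bool) : is_tree_aut f ->
  label_perm f y m s = label_act f y s.
Proof.
move=> fA; rewrite -pvalE insubdK ?ffunE //.
apply/injectiveP => a b; rewrite !ffunE; exact: label_act_inj.
Qed.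

Lemma is_tree_aut_id : is_tree_aut id.
Proof. by split => //; exists id. Qed.

Lemma is_tree_aut_comp f g :
  is_tree_aut f -> is_tree_aut g -> is_tree_aut (f \o g).
Proof.
move=> [fb f0 fP] [gb g0 gP]; split; first exact: bij_comp.
  by rewrite /= g0.
by move=> x y /=; rewrite fP gP.
Qed.

Lemma sgn_id m y : sgn m id y = 1%g.
Proof.
rewrite /sgn; have -> : label_perm id y m = 1%g; last by rewrite odd_perm1.
apply/permP => s; rewrite perm1 (label_permE _ _ is_tree_aut_id).
have := label_actP y s is_tree_aut_id; rewrite node_ofK => /eqP.
by rewrite eqseq_cat // eqxx => /eqP/val_inj.
Qed.

Lemma sgn_comp m f g y : is_tree_aut f -> is_tree_aut g ->
  sgn m (f \o g) y = (sgn m f (g y) * sgn m g y)%g.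
Proof.
move=> fA gA; have fgA := is_tree_aut_comp fA gA.
rewrite /sgn -pm1_signM addbC -odd_permM; congr (pm1_sign (odd_perm _)).
apply/permP => s; rewrite permM !label_permE //; apply: val_inj.
have := label_actP y s fgA; rewrite /=.
have := label_actP y s gA => /(congr1 (node_of L)); rewrite labelK => ->.
by rewrite label_actP // => /eqP; rewrite eqseq_cat // eqxx => /eqP.
Qed.

Lemma M_group_set l n : group_set (M_set l n).
Proof.
apply/group_setP; split.
  rewrite inE; apply/asboolP; exists id; split; last by move=> x; rewrite perm1.
  by split=> [|y]; [exact: is_tree_aut_id | rewrite sgn_id].
move=> s t; rewrite !inE => /asboolP[f [[fA fM] fs]] /asboolP[g [[gA gM] gt]].
apply/asboolP; exists (g \o f); split; last by move=> x; rewrite permM gt fs.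
split; first exact: is_tree_aut_comp.
by move=> y; rewrite sgn_comp // fM gM pm1_sign0 mulg1.
Qed.

Canonical M l n : {group {perm n.-bseq bool}} := Group (M_group_set l n).

(* On M_set l n the signs computed from the extension agree with those of any
   automorphism of the infinite tree that it restricts. *)
Lemma sgn_extend n m f (s : {perm n.-bseq bool}) y : is_tree_aut f ->
  restricts f s -> size y + m <= n -> sgn m (extend s) y = sgn m f y.
Proof.
move=> fA fs ymn; rewrite /sgn /label_perm.
congr (pm1_sign (odd_perm (insubd _ _))); apply/ffunP => t.
rewrite !ffunE /label_act; congr (insubd _ (drop _ (label L _))).
rewrite /extend; case: insubP => [x' _ xE | ]; first by rewrite fs xE.
by rewrite -(size_label L) node_ofK size_cat size_label size_tuple ymn.
Qed.

End Sign.

(* Main.v *)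
(* Record a tree automorphism by its portrait, the set of nodes (read as words
   through the labeling) whose two children it exchanges. Only the exchanges at
   relative depth m - 1 above y matter for sgn_m(-, y), so M_l consists of the
   portraits having, for every w, an even number of exchanges at relative depth
   l - 1 above w, and the coordinate e_(i+1) of psi is a parity of exchanges on
   level i. Both conditions involve one level at a time.

   Hence psi is surjective, and an element of its kernel can be peeled level by
   level: it suffices to treat a portrait p supported on one level j. If g is
   supported below level j, the commutator of the two automorphisms has portrait
   p + p o g, so everything reduces to writing the portraits on level j with
   e_(j+1) = 0 as sums of such differences. Two kinds of g suffice: bitwise
   translations by a word, and translations performed only where a given bit has
   a given value; both lie in M_l, since they do not distinguish the values of
   the first of the l - 1 bits over which the parity is taken. *)

Require Import Defs.
From mathcomp Require Import all_boot all_fingroup.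
From mathcomp Require Import zify boolp.

Set Implicit Arguments.
Unset Strict Implicit.
Unset Printing Implicit Defensive.

(** * The group of signs and the parity of permutations *)

Lemma pm1_sign_inj : injective pm1_sign.
Proof. by case=> [] [] // /(congr1 val). Qed.

Lemma pm1_signP (x : pm1) : exists b, x = pm1_sign b.
Proof.
case: x => x xP; have := xP; rewrite !inE => /orP[] /eqP xE.
  by exists false; apply: val_inj.
by exists true; apply: val_inj.
Qed.

Lemma mulgC_pm1 (x y : pm1) : (x * y = y * x)%g.
Proof.
by have [[a ->] [b ->]] := (pm1_signP x, pm1_signP y); rewrite -!pm1_signM addbC.
Qed.

Lemma is_childP (x y : node) : reflect (exists b, y = rcons x b) (is_child x y).
Proof.
apply: (iffP orP) => [[] /eqP-> | [[] ->]]; first by exists false.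
- by exists true.
- by right.
- by left.
Qed.

Lemma odd_card (T : finType) (A : {set T}) :
  odd #|A| = \big[addb/false]_(x : T) (x \in A).
Proof.
rewrite -sum1_card (big_morph odd oddD (erefl _)) big_mkcond /=.
by apply: eq_bigr => x _; case: ifP.
Qed.

Lemma eq_cat_cons (T : eqType) (y w s t : seq T) b c : size s = size t ->
  (w ++ b :: t == y ++ c :: s) = [&& w == y, b == c & t == s].
Proof.
move=> st; have [wy|wy] := eqVneq (size w) (size y).
  by rewrite eqseq_cat // eqseq_cons.
transitivity false.
  apply/eqP => /(congr1 size)/eqP; rewrite !size_cat /= st eqn_add2r.
  by rewrite (negPf wy).
by case: eqP => // wE; rewrite wE eqxx in wy.
Qed.

(** Think of [X] as [T] with two-point fibers: [t] covers [s] and flips some fibers. The part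
    covering [s] acts on two copies of [T], so its sign is squared away; each flip is one
    transposition. *)
Lemma odd_perm_wreath (T X : finType) (e : T -> bool -> X) (s : {perm T})
    (p : T -> bool) (t : {perm X}) :
    (forall x a y b, e x a = e y b -> x = y /\ a = b) ->
    (forall z, exists x a, z = e x a) ->
    (forall x a, t (e x a) = e (s x) (a (+) p x)) ->
  odd_perm t = \big[addb/false]_x p x.
Proof.
move=> eI eS; have [ts -> _] := prod_tpermP s.
have eI1 c : injective (e^~ c) by move=> x y /eI[].
have eE x y a b : (e x a == e y b) = (x == y) && (a == b).
  by apply/eqP/andP => [/eI[-> ->] | [/eqP-> /eqP->]].
elim: ts p t => [|[x y] ts IHts] p t; last first.
  rewrite big_cons /= => tE.
  (* A transposition of the base lifts to one on each of the two sheets; removing the pair keeps the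
     parity of [t] and only permutes [p]. *)
  pose u c := tperm (e x c) (e y c).
  have uE c z d : u c (e z d) = e (if d == c then tperm x y z else z) d.
    case: eqP => [->|/eqP dc]; first by rewrite (inj_tperm _ _ _ (@eI1 c)).
    by rewrite tpermD // eE negb_and [c == d]eq_sym dc orbT.
  have := IHts (p \o tperm x y) (u false * (u true * t))%g.
  rewrite !odd_mul_tperm !eE !eqxx !andbT addKb => ->.
    by rewrite /= [RHS](reindex_inj (@perm_inj _ (tperm x y))).
  by move=> z c; rewrite !permM !uE; case: c; rewrite /= tE permM tpermK.
(* The base is now fixed pointwise: undo the flips one at a time, by induction on their number. *)
rewrite big_nil => {s}; have [k] := ubnP #|[pred x | p x]|.
elim: k p t => // k IHk p t lek tE; case: (pickP p) => [x px | p0]; last first.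
  rewrite big1 //; suff -> : t = 1%g by rewrite odd_perm1.
  by apply/permP => z; have [x [a ->]] := eS z; rewrite tE !perm1 p0 addbF.
pose q z := p z (+) (z == x).
have := IHk q (tperm (e x false) (e x true) * t)%g.
rewrite odd_mul_tperm eE eqxx /= big_split /=.
rewrite (bigD1 x (P := xpredT) (F := fun z => z == x)) //= eqxx.
rewrite [X in true (+) X]big1; last by move=> z /negPf.
rewrite !addbT => H; apply: negb_inj; apply: H.
  rewrite -ltnS; apply: leq_trans lek; rewrite ltnS [X in _ < X](cardD1 x) inE px ltnS.
  apply: subset_leq_card; apply/subsetP => z; rewrite !inE /q.
  by have [->|] := eqVneq z x; rewrite ?px // addbF.
move=> z a; rewrite permM /q; have [->|zx] := eqVneq z x.
  by rewrite px; case: a; rewrite ?tpermL ?tpermR tE perm1 px.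
by rewrite tpermD ?tE ?perm1 ?addbF // eE negb_and eq_sym zx.
Qed.

(** * Sums modulo 2 over the words of a given length *)

Definition xsum m (f : seq bool -> bool) : bool :=
  \big[addb/false]_(v : m.-tuple bool) f v.

Lemma eq_xsum m (f g : seq bool -> bool) :
  (forall v, size v = m -> f v = g v) -> xsum m f = xsum m g.
Proof. by move=> fg; apply: eq_bigr => v _; rewrite fg ?size_tuple. Qed.

Lemma xsum0 m (f : seq bool -> bool) :
  (forall v, size v = m -> f v = false) -> xsum m f = false.
Proof. by move=> f0; rewrite /xsum big1 // => v _; rewrite f0 ?size_tuple. Qed.

Lemma xsumD m (f g : seq bool -> bool) :
  xsum m (fun v => f v (+) g v) = xsum m f (+) xsum m g.
Proof. exact: big_split. Qed.

Lemma xsumZ m a (f : seq bool -> bool) :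
  xsum m (fun v => a && f v) = a && xsum m f.
Proof. by rewrite /xsum big_distrr. Qed.

Lemma xsum_reindex m (h : seq bool -> seq bool) (f : seq bool -> bool) :
    (forall v, size (h v) = size v) -> injective h ->
  xsum m (fun v => f (h v)) = xsum m f.
Proof.
move=> hs hI; pose k (v : m.-tuple bool) : m.-tuple bool := insubd v (h v).
have kE v : k v = h v :> seq bool.
  by rewrite /k val_insubd /= hs size_tuple eqxx.
have kI : injective k by move=> u v /(congr1 val); rewrite /= !kE => /hI/val_inj.
by rewrite /xsum [RHS](reindex_inj kI); apply: eq_bigr => v _; rewrite kE.
Qed.

Lemma xsum_cons m (f : seq bool -> bool) :
  xsum m.+1 f = xsum m (fun v => f (false :: v)) (+) xsum m (fun v => f (true :: v)).
Proof.
rewrite /xsum.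
rewrite (reindex (fun bv : bool * m.-tuple bool => [tuple of bv.1 :: bv.2])) /=; last first.
  exists (fun v => (thead v, [tuple of behead v])) => [[b v] _|v _].
    by congr pair; apply: val_inj.
  by rewrite [RHS]tuple_eta.
rewrite -(pair_bigA _ (fun b (v : m.-tuple bool) => f (b :: v))) /=.
by rewrite big_bool addbC.
Qed.

Lemma xsum_cat m k (f : seq bool -> bool) :
  xsum (m + k) f = xsum m (fun u => xsum k (fun v => f (u ++ v))).
Proof.
elim: m f => [|m IHm] f; last by rewrite addSn !xsum_cons !IHm.
by rewrite {2}/xsum (big_pred1 [tuple]) // => v; apply/esym/eqP/tuple0.
Qed.

Lemma xsum_delta m (x : seq bool) (f : seq bool -> bool) :
  size x = m -> xsum m (fun v => f v && (x == v)) = f x.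
Proof.
move=> sx; have sxt : size x == m by rewrite sx.
rewrite /xsum (bigD1 (Tuple sxt)) //= eqxx andbT big1 ?addbF // => v.
by rewrite -val_eqE eq_sym /= => /negPf->; rewrite andbF.
Qed.

Lemma xsum_head_invariant m (f : seq bool -> bool) :
    0 < m ->
    (forall v, size v = m.-1 -> f (false :: v) = f (true :: v)) ->
  xsum m f = false.
Proof.
by case: m => // m _ fE; rewrite xsum_cons (eq_xsum fE) addbb.
Qed.

(** * Action of a portrait on words *)

Fixpoint act (p : seq bool -> bool) (w : seq bool) : seq bool :=
  if w is b :: w' then (b (+) p [::]) :: act (fun v => p (b :: v)) w' else [::].

(** Portraits are indexed by words before the action, so the inverse has to read [p] along the
    letters that it has already recovered. *)
Fixpoint act_inv (p : seq bool -> bool) (w : seq bool) : seq bool :=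
  if w is b :: w' then
    (b (+) p [::]) :: act_inv (fun v => p ((b (+) p [::]) :: v)) w'
  else [::].

Lemma actK p : cancel (act p) (act_inv p).
Proof. by move=> w; elim: w p => //= b w IHw p; rewrite addbK IHw. Qed.

Lemma act_invK p : cancel (act_inv p) (act p).
Proof. by move=> w; elim: w p => //= b w IHw p; rewrite addbK IHw. Qed.

Lemma act_inj p : injective (act p).
Proof. exact: can_inj (actK p). Qed.

Lemma size_act p w : size (act p w) = size w.
Proof. by elim: w p => //= b w IHw p; rewrite IHw. Qed.

Lemma act_cat p u v : act p (u ++ v) = act p u ++ act (fun w => p (u ++ w)) v.
Proof. by elim: u p => //= b u IHu p; rewrite IHu. Qed.

Lemma act_rcons p w b : act p (rcons w b) = rcons (act p w) (b (+) p w).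
Proof. by rewrite -cats1 act_cat /= cats0 cats1. Qed.

Lemma eq_act (p q : seq bool -> bool) w :
  (forall v, size v < size w -> p v = q v) -> act p w = act q w.
Proof.
elim: w p q => //= b w IHw p q pq; congr (_ :: _); first by rewrite pq.
by apply: IHw => v sv; rewrite pq.
Qed.

Lemma nth_act p w i : i < size w ->
  nth false (act p w) i = nth false w i (+) p (take i w).
Proof. by elim: w p i => //= b w IHw p [|i] //= /IHw->. Qed.

Lemma act_fix p w : (forall v, size v < size w -> p v = false) -> act p w = w.
Proof.
move=> p0; apply: (@eq_from_nth _ false); rewrite size_act // => i iw.
by rewrite nth_act // p0 ?addbF // size_take iw.
Qed.

(** The cocycle rule for acting by [p] first and [q] second, the order of products of
    permutations. *)
Definition portrait_mul (p q : seq bool -> bool) (w : seq bool) : bool :=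
  p w (+) q (act p w).

Lemma act_mul p q w : act (portrait_mul p q) w = act q (act p w).
Proof.
elim: w p q => //= b w IHw p q; rewrite -IHw.
by congr (_ :: _); rewrite /portrait_mul /= addbA.
Qed.

(** * Portraits and automorphisms of the infinite tree *)

Section Portraits.

Variable L : labeling.
Implicit Types (p q : seq bool -> bool) (w x y : seq bool).

Lemma size_node_of w : size (node_of L w) = size w.
Proof. by rewrite -(size_label L) node_ofK. Qed.

Definition portrait_aut p x : node := node_of L (act p (label L x)).

Lemma steps_act p : steps (act p).
Proof. by move=> w b; rewrite act_rcons; eexists. Qed.

Lemma steps_act_inv p : steps (act_inv p).
Proof.
move=> w b; exists (b (+) p (act_inv p w)); apply: (@act_inj p).
by rewrite act_rcons !act_invK addbK.
Qed.

Lemma portrait_aut_is_tree_aut p : is_tree_aut (portrait_aut p).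
Proof.
pose g x := node_of L (act_inv p (label L x)).
have fK : cancel (portrait_aut p) g.
  by move=> x; rewrite /g /portrait_aut node_ofK actK labelK.
have gK : cancel g (portrait_aut p).
  by move=> x; rewrite /g /portrait_aut node_ofK act_invK labelK.
have fS : steps (portrait_aut p) :=
  steps_comp (steps_comp (steps_node_of L) (steps_act p)) (steps_label L).
have gS : steps g :=
  steps_comp (steps_comp (steps_node_of L) (steps_act_inv p)) (steps_label L).
split; first by exists g.
  by apply: size0nil; rewrite size_node_of size_act size_label.
move=> x y; apply/is_childP/is_childP => [[b] | [b ->]]; last exact: fS.
by move/(congr1 g); rewrite fK => ->; rewrite -[in rcons x](fK x); apply: gS.
Qed.

Lemma size_portrait_aut p x : size (portrait_aut p x) = size x.
Proof. by rewrite size_node_of size_act size_label. Qed.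

(** For a tree automorphism, the children of [w] are exchanged exactly when the child ending in [0]
    is sent to a word ending in [1]. *)
Definition portrait (f : node -> node) w : bool :=
  last false (label L (f (node_of L (rcons w false)))).

Lemma portrait_autE f : is_tree_aut f -> f = portrait_aut (portrait f).
Proof.
move=> fA; pose F w := label L (f (node_of L w)).
have FS : steps F :=
  steps_comp (steps_comp (steps_label L) (steps_aut fA)) (steps_node_of L).
have FI : injective F.
  move=> v w /(can_inj (labelK L)); case: fA => /bij_inj fI _ _ /fI.
  exact: (can_inj (node_ofK L)).
suff FE w : F w = act (portrait f) w.
  by apply/funext => x; rewrite /portrait_aut -FE /F !labelK.
elim/last_ind: w => [|w b IHw].
  by apply: size0nil; rewrite size_label size_aut // size_node_of.
rewrite act_rcons -IHw.
have [c Ec] := FS w false; have [d Ed] := FS w true.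
have -> : portrait f w = c by rewrite /portrait -/(F (rcons w false)) Ec last_rcons.
case: b => //; rewrite Ed; congr rcons.
(* By injectivity the other child takes the remaining letter, so one bit per node determines the
   automorphism. *)
have /eqP : F (rcons w false) <> F (rcons w true).
  by move/FI/rcons_inj => [].
by rewrite Ec Ed eqseq_rcons eqxx; case: (c) (d) => [] [].
Qed.

Lemma label_act_portrait p y m (s : m.-tuple bool) :
  label_act L (portrait_aut p) y s = act (fun w => p (label L y ++ w)) s :> seq bool.
Proof.
have := label_actP L y s (portrait_aut_is_tree_aut p).
rewrite /portrait_aut !node_ofK act_cat => /eqP.
by rewrite eqseq_cat // eqxx => /eqP/esym.
Qed.

(** Words of length [m.+1] fiber over their prefixes of length [m]; by [odd_perm_wreath] only the
    exchanges of last letters count. *)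
Lemma sgn_portrait p y m :
  sgn L m.+1 (portrait_aut p) y = pm1_sign (xsum m (fun v => p (label L y ++ v))).
Proof.
congr pm1_sign; have fA := portrait_aut_is_tree_aut p.
apply: (@odd_perm_wreath _ _ (fun (s : m.-tuple bool) b => [tuple of rcons s b])
  (label_perm L (portrait_aut p) y m) (fun s => p (label L y ++ s))).
- by move=> s a t b /(congr1 val)/rcons_inj[/val_inj].
- move=> [s]; case/lastP: s => // s b sbP.
  have sP : size s == m by move: sbP; rewrite size_rcons.
  by exists (Tuple sP), b; apply: val_inj.
move=> s a; apply: val_inj.
by rewrite /= !label_permE // !label_act_portrait act_rcons.
Qed.

(** * Portraits of the elements of $M_{\ell,n}$ *)

Variables l n : nat.
Hypothesis l_ge2 : 2 <= l.

Definition balanced p := forall w, xsum l.-1 (fun v => p (w ++ v)) = false.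

Lemma in_M_portrait p : in_M L l (portrait_aut p) <-> balanced p.
Proof.
have lE : l = l.-1.+1 by case: (l) l_ge2.
split=> [[_ pM] w | pB].
  apply: pm1_sign_inj; rewrite -(pM (node_of L w)).
  by rewrite [in RHS]lE sgn_portrait node_ofK.
split=> [|y]; first exact: portrait_aut_is_tree_aut.
by rewrite lE sgn_portrait pB.
Qed.

Definition portrait_bseq p (x : n.-bseq bool) : n.-bseq bool :=
  insubd x (portrait_aut p x).

Lemma val_portrait_bseq p (x : n.-bseq bool) : portrait_bseq p x = portrait_aut p x :> seq bool.
Proof. by rewrite /portrait_bseq val_insubd /= size_portrait_aut size_bseq. Qed.

Lemma portrait_bseq_inj p : injective (portrait_bseq p).
Proof.
move=> x y /(congr1 val); rewrite /= !val_portrait_bseq => E.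
have [/bij_inj fI _ _] := portrait_aut_is_tree_aut p.
by apply: val_inj; apply: fI.
Qed.

Definition portrait_perm p : {perm n.-bseq bool} := perm (@portrait_bseq_inj p).

Lemma restricts_portrait p : restricts (portrait_aut p) (portrait_perm p).
Proof. by move=> x; rewrite permE val_portrait_bseq. Qed.

Lemma portrait_perm_in p : balanced p -> portrait_perm p \in M L l n.
Proof.
move=> pB; rewrite inE; apply/asboolP; exists (portrait_aut p).
by split; [apply/in_M_portrait | apply: restricts_portrait].
Qed.

Lemma M_portrait s : s \in M L l n -> exists2 p, balanced p & s = portrait_perm p.
Proof.
rewrite inE => /asboolP[f [fM fs]]; have [fA _] := fM.
rewrite (portrait_autE fA) in fM fs; exists (portrait f).
  exact/in_M_portrait.
by apply/permP => x; apply: val_inj; rewrite /= fs restricts_portrait.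
Qed.

Lemma portrait_permM p q :
  portrait_perm (portrait_mul p q) = (portrait_perm p * portrait_perm q)%g.
Proof.
apply/permP => x; apply: val_inj; rewrite permM /= !restricts_portrait.
by rewrite /portrait_aut node_ofK act_mul.
Qed.

Lemma eq_portrait_perm p q :
  (forall w, size w < n -> p w = q w) -> portrait_perm p = portrait_perm q.
Proof.
move=> pq; apply/permP => x; apply: val_inj; rewrite /= !restricts_portrait.
congr node_of; apply: eq_act => v; rewrite size_label => vx; apply: pq.
exact: leq_trans vx (size_bseq x).
Qed.

Lemma portrait_perm_inj p q : portrait_perm p = portrait_perm q ->
  forall w, size w < n -> p w = q w.
Proof.
move=> pq w wn.
have xP : size (node_of L (rcons w false)) <= n by rewrite size_node_of size_rcons.
have := congr1 (fun s : {perm n.-bseq bool} => s (Bseq xP) : seq bool) pq.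
rewrite /= !restricts_portrait /portrait_aut /= node_ofK.
by move/(can_inj (node_ofK L)); rewrite !act_rcons => /rcons_inj[].
Qed.

(** * The coordinates of $\psi_n$ read off portraits *)

Definition half_parity p w := xsum l.-2 (fun t => p (w ++ t)).

(* For [i.+1 >= l] the two halves above a word have the same parity when [p] is
   balanced, so the half above [rcons v false] alone tells whether the
   automorphism acts negatively above [v]. *)
Definition psi_exponent p i : bool :=
  if i.+1 < l then xsum i p
  else xsum (i.+1 - l) (fun v => half_parity p (rcons v false)).

(** By [sgn_portrait], [half_parity] is the exponent of $\operatorname{sgn}_{\ell-1}$. The halves
    over the two children add up to the balance sum over [w], which vanishes. *)
Lemma balanced_half_parity p w b : balanced p ->
  half_parity p (rcons w b) = half_parity p (rcons w false).
Proof.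
case: b => // /(_ w); rewrite /half_parity.
case: l l_ge2 => [|[|k]] //= _; rewrite xsum_cons => H.
under eq_xsum do rewrite cat_rcons; under [RHS]eq_xsum do rewrite cat_rcons.
by apply/esym/eqP; rewrite -negb_add H.
Qed.

Lemma eq_psi_exponent p q i : (forall w, size w = i -> p w = q w) ->
  psi_exponent p i = psi_exponent q i.
Proof.
move=> pq; rewrite /psi_exponent; case: ltnP => il; first exact: eq_xsum.
apply: eq_xsum => v sv; apply: eq_xsum => t st; apply: pq.
by rewrite size_cat size_rcons sv st; case: (l) l_ge2 il => [|[|k]] //= _; lia.
Qed.

Lemma sgn_portrait_perm p y m : size y + m.+1 <= n ->
  sgn L m.+1 (extend (portrait_perm p)) y =
  pm1_sign (xsum m (fun v => p (label L y ++ v))).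
Proof.
move=> ymn; rewrite -sgn_portrait.
exact: sgn_extend (portrait_aut_is_tree_aut p) (restricts_portrait p) ymn.
Qed.

Lemma acts_negatively_portrait p w : balanced p -> size w + l <= n ->
  acts_negatively L l (extend (portrait_perm p)) w =
  half_parity p (rcons (label L w) false).
Proof.
move=> pB wl.
have H b : sgn L l.-1 (extend (portrait_perm p)) (rcons w b) =
    pm1_sign (half_parity p (rcons (label L w) false)).
  have -> : l.-1 = l.-2.+1 by case: (l) l_ge2 => [|[]].
  rewrite sgn_portrait_perm; last first.
    by rewrite size_rcons; case: (l) l_ge2 wl => [|[|k]] //= _; lia.
  have [c ->] := steps_label L w b; congr pm1_sign.
  exact: balanced_half_parity.
by rewrite /acts_negatively !H andbb (inj_eq pm1_sign_inj); case: half_parity.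
Qed.

Lemma psi_portrait p (i : 'I_n) : balanced p ->
  psi L l (portrait_perm p) i = pm1_sign (psi_exponent p i).
Proof.
move=> pB; rewrite ffunE /psi_exponent; case: ltnP => il.
  rewrite (@sgn_portrait_perm p Defs.root i (ltn_ord i)); congr pm1_sign; apply: eq_xsum => v _.
  by rewrite (size0nil (size_label L Defs.root)).
congr pm1_sign; rewrite /odd_cousins odd_card.
(* One count runs over nodes, the other over words; the labeling is a bijection on each level. *)
rewrite -(xsum_reindex _ _ (size_label L) (can_inj (labelK L))).
apply: eq_bigr => v _; rewrite inE acts_negatively_portrait //.
by rewrite size_tuple subnK.
Qed.

(** The action of [p] maps the words extending [w] bijectively onto those extending [act p w], so
    the twist in the cocycle rule only permutes the terms. *)
Lemma xsum_portrait_mul p q m w :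
  xsum m (fun v => portrait_mul p q (w ++ v)) =
  xsum m (fun v => p (w ++ v)) (+) xsum m (fun v => q (act p w ++ v)).
Proof.
rewrite xsumD; congr addb; under eq_xsum do rewrite act_cat.
exact: (xsum_reindex _ (fun v => q (act p w ++ v)) (size_act _) (@act_inj _)).
Qed.

Lemma balanced_mul p q : balanced p -> balanced q -> balanced (portrait_mul p q).
Proof. by move=> pB qB w; rewrite xsum_portrait_mul pB qB. Qed.

Lemma psi_exponentM p q i : balanced q ->
  psi_exponent (portrait_mul p q) i = psi_exponent p i (+) psi_exponent q i.
Proof.
move=> qB; rewrite /psi_exponent; case: ltnP => il.
  exact: (xsum_portrait_mul p q i [::]).
under eq_xsum do rewrite /half_parity xsum_portrait_mul act_rcons.
rewrite xsumD; congr addb.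
(* [p] may carry a child [0] to a child [1]; as [q] is balanced, both halves have the same
   parity. *)
under eq_xsum do rewrite -/(half_parity q _) balanced_half_parity //.
exact: (xsum_reindex _ (fun v => half_parity q (rcons v false)) (size_act _)
  (@act_inj _)).
Qed.

Lemma psiM : {in M L l n &, {morph @psi L l n : s t / (s * t)%g}}.
Proof.
move=> _ _ /M_portrait[p pB ->] /M_portrait[q qB ->].
apply/ffunP => i; rewrite -portrait_permM psi_portrait; last exact: balanced_mul.
rewrite psi_exponentM // pm1_signM [RHS]ffunE.
by rewrite !psi_portrait.
Qed.

(** * Surjectivity of $\psi_n$ *)

Definition zeros : nat -> seq bool := nseq^~ false.

(** The simplest balanced portrait acting negatively above [y]: one exchange over each child of [y],
    at relative depth [l.-1] above [y]. *)
Definition fork y w : bool :=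
  (w == y ++ false :: zeros l.-2) (+) (w == y ++ true :: zeros l.-2).

Lemma fork_cat y w b t : size t = l.-2 ->
  fork y (w ++ b :: t) = (w == y) && (t == zeros l.-2).
Proof.
move=> st; rewrite /fork !eq_cat_cons ?size_nseq ?st //.
by case: (w == y); case: b => /=; rewrite ?addbF.
Qed.

(** Toggling the first of the [l.-1] summed bits pairs off the terms. *)
Lemma balancedI p :
    (forall w t, size t = l.-2 -> p (w ++ false :: t) = p (w ++ true :: t)) ->
  balanced p.
Proof.
move=> pE w; apply: xsum_head_invariant; first by case: (l) l_ge2 => [|[]].
by move=> v; case: (l) pE l_ge2 => [|[|k]] //= pE _; apply: pE.
Qed.

Lemma balanced_fork y : balanced (fork y).
Proof. by apply: balancedI => w t st; rewrite !fork_cat. Qed.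

(** A right inverse of [psi_exponent]: each level chosen by [c] gets a single exchange or a fork.
    The base of the fork has length [(size w).+1 - l], which puts its exchanges on the level of
    [w]. *)
Definition psi_section (c : nat -> bool) w : bool :=
  c (size w) &&
  (if (size w).+1 < l then w == zeros (size w)
   else fork (zeros ((size w).+1 - l)) w).

Lemma balanced_psi_section c : balanced (psi_section c).
Proof.
apply: balancedI => w t st; rewrite /psi_section !size_cat /= st.
(* Words in a balance sum have length at least [l.-1], so the single exchanges of lower levels never
   enter one. *)
rewrite ltnNge; have -> /= : l <= (size w + l.-2.+1).+1 by lia.
by rewrite !fork_cat.
Qed.

Lemma psi_exponent_section c i : psi_exponent (psi_section c) i = c i.
Proof.
rewrite /psi_exponent; case: ltnP => il.
  rewrite -[RHS](@xsum_delta i (zeros i) (fun=> c i)) ?size_nseq //.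
  by apply: eq_xsum => v sv; rewrite /psi_section sv il eq_sym.
rewrite -[RHS](@xsum_delta (i.+1 - l) (zeros (i.+1 - l)) (fun=> c i)) ?size_nseq //.
apply: eq_xsum => v sv; rewrite eq_sym.
rewrite -[RHS](@xsum_delta l.-2 (zeros l.-2) (fun=> c i && (v == zeros (i.+1 - l))))
  ?size_nseq //.
apply: eq_xsum => t st; rewrite /psi_section cat_rcons fork_cat // size_cat /= sv st.
have -> : (i.+1 - l + l.-2.+1) = i by case: (l) l_ge2 il => [|[|k]] //= _; lia.
by rewrite ltnNge il /= andbA [t == _]eq_sym.
Qed.

Lemma psi_surjective (e : {dffun forall i : 'I_n, pm1}) :
  exists2 s, s \in M L l n & psi L l s = e.
Proof.
pose c k := if insub k is Some i then e i == pm1_sign true else false.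
exists (portrait_perm (psi_section c)).
  exact/portrait_perm_in/balanced_psi_section.
apply/ffunP => i; rewrite psi_portrait; last exact: balanced_psi_section.
rewrite psi_exponent_section /c valK; have [b ->] := pm1_signP (e i).
by rewrite (inj_eq pm1_sign_inj); case: b.
Qed.

(** * Single-level portraits and their commutators *)

Definition on_level j p := forall w, size w != j -> p w = false.

Lemma act_on_level j p w : on_level j p -> size w <= j -> act p w = w.
Proof.
move=> pj wj; apply: act_fix => v vw; apply: pj.
by rewrite neq_ltn (leq_trans vw).
Qed.

Lemma on_levelD j p q : on_level j p -> on_level j q ->
  on_level j (fun w => p w (+) q w).
Proof. by move=> pj qj w wj; rewrite pj ?qj. Qed.

(** Words of length at most [j] are fixed, so the cocycle rule loses its twist and products become
    sums modulo 2. *)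
Lemma portrait_permD j p q : on_level j p -> on_level j q ->
  portrait_perm (fun w => p w (+) q w) = (portrait_perm p * portrait_perm q)%g.
Proof.
move=> pj qj; rewrite -portrait_permM; apply: eq_portrait_perm => w _.
rewrite /portrait_mul; have [wj|wj] := eqVneq (size w) j.
  by rewrite (act_on_level pj) ?wj.
by rewrite !qj ?size_act.
Qed.

Lemma portrait_perm1 p : (forall w, size w < n -> p w = false) ->
  portrait_perm p = 1%g.
Proof.
move=> p0; apply/permP => x; apply: val_inj; rewrite /= restricts_portrait perm1.
rewrite /portrait_aut act_fix ?labelK // => v; rewrite size_label => vx.
by rewrite p0 // (leq_trans vx) // size_bseq.
Qed.

Local Notation G := (M L l n).

(* For [x] the involution with portrait [p] and [y] the automorphism with
   portrait [g], this is the commutator of [x] and [y^-1]. *)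
Lemma portrait_perm_commutator j p g :
    on_level j p -> (forall w, j <= size w -> g w = false) ->
    balanced p -> balanced g ->
  portrait_perm (fun w => p w (+) p (act g w)) \in [~: G, G]%g.
Proof.
move=> pj gj pB gB; pose q w := p (act g w).
have qj : on_level j q by move=> w wj; rewrite /q pj ?size_act.
rewrite (portrait_permD pj qj).
have pp : (portrait_perm p * portrait_perm p = 1)%g.
  by rewrite -(portrait_permD pj pj); apply: portrait_perm1 => w _; rewrite addbb.
(* The portraits to compare are [g w (+) q w] and [q w (+) g (act q w)]: up to level [j], [act q]
   fixes [w]; beyond it [g] vanishes. *)
have E : (portrait_perm g * portrait_perm p = portrait_perm q * portrait_perm g)%g.
  rewrite -!portrait_permM; apply: eq_portrait_perm => w _; rewrite /portrait_mul.
  rewrite addbC -/(q w); congr addb; case: (leqP (size w) j) => wj.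
    by rewrite (act_on_level qj).
  by rewrite !gj ?size_act // ltnW.
have -> : (portrait_perm p * portrait_perm q =
    [~ portrait_perm p, (portrait_perm g)^-1])%g.
  rewrite commgEl conjgE invgK [in RHS](mulgA (portrait_perm g)) E mulgK.
  by congr (_ * _)%g; apply/eqP; rewrite eq_sym eq_invg_mul pp.
by apply: mem_commg; rewrite ?groupV portrait_perm_in.
Qed.

(** The portraits on one level that give elements of the commutator subgroup are closed under linear
    combinations modulo 2. *)
Lemma portrait_perm_xsum j m (a : seq bool -> bool) (u : seq bool -> seq bool -> bool) :
    (forall x, size x = m -> on_level j (u x)) ->
    (forall x, size x = m -> portrait_perm (u x) \in [~: G, G]%g) ->
  let p w := xsum m (fun x => a x && u x w) in
  on_level j p /\ portrait_perm p \in [~: G, G]%g.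
Proof.
move=> uj uC p; split=> [w wj|]; first by apply: xsum0 => x xm; rewrite uj ?andbF.
rewrite /p /xsum; elim: (index_enum _) => [|x r IHr].
  by rewrite portrait_perm1 ?group1 // => w _; rewrite big_nil.
have xm := size_tuple x.
pose q1 w := a x && u x w.
pose q2 w := \big[addb/false]_(y <- r) (a y && u y w).
have q1j : on_level j q1 by move=> w wj; rewrite /q1 uj ?andbF.
have q2j : on_level j q2.
  by move=> w wj; apply: big1 => y _; rewrite uj ?andbF ?size_tuple.
rewrite (@eq_portrait_perm _ (fun w => q1 w (+) q2 w)); last first.
  by move=> w _; rewrite big_cons.
rewrite (portrait_permD q1j q2j) groupM //.
have [ax|ax] := boolP (a x).
  by rewrite (@eq_portrait_perm _ (u x)) ?uC // => w _; rewrite /q1 ax.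
by rewrite portrait_perm1 ?group1 // => w _; rewrite /q1 (negPf ax).
Qed.

(** * Translations and half translations *)

Definition translation x w : bool := nth false x (size w).

Lemma balanced_translation x : balanced (translation x).
Proof. by apply: balancedI => w t _; rewrite /translation !size_cat. Qed.

Lemma act_translation x t : act (translation x) (x ++ t) = zeros (size x) ++ t.
Proof.
rewrite act_cat; congr cat; last first.
  by apply: act_fix => v _; rewrite /translation nth_default // size_cat leq_addr.
apply: (@eq_from_nth _ false); rewrite size_act ?size_nseq // => i ix.
by rewrite nth_act // /translation size_take ix addbb nth_nseq if_same.
Qed.

(* Translates, by [s], the bits following the one at position [r], but only
   where the latter is equal to [b]. *)
Definition half_translation r b (s w : seq bool) : bool :=
  [&& r < size w, nth (~~ b) w r == b & nth false s (size w - r.+1)].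

(** The toggled letter is the tested one only when [size w] is [r]; the index into [s] is then
    [l.-2], where [s] has run out and [nth] returns [false]. *)
Lemma balanced_half_translation r b s : size s = l.-2 ->
  balanced (half_translation r b s).
Proof.
move=> sl; apply: balancedI => w t tl; rewrite /half_translation !size_cat /= tl.
have [wr|wr] := eqVneq (size w) r.
  by rewrite (nth_default _ (s := s)) ?andbF // sl wr; lia.
by rewrite !nth_cat; case: (ltnP r (size w)) => // rw; case E: (r - size w) => [|k] //; lia.
Qed.

Lemma act_half_translation r b s y c t : size y = r ->
  act (half_translation r b s) (y ++ c :: t) =
  y ++ c :: (if c == b then act (translation s) t else t).
Proof.
move=> yr; rewrite act_cat act_fix; last first.
  by move=> v; rewrite yr /half_translation => vr; rewrite ltnNge ltnW.
rewrite /= {1}/half_translation cats0 yr ltnn addbF; congr (_ ++ _ :: _).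
have hE v : half_translation r b s (y ++ c :: v) = (c == b) && translation s v.
  rewrite /half_translation size_cat nth_cat yr ltnn subnn /=.
  by rewrite addnS ltnS leq_addr /= subSS addKn.
have [cb|cb] := eqVneq c b.
  by apply: eq_act => v _; rewrite hE cb eqxx.
by apply: act_fix => v _; rewrite hE (negPf cb).
Qed.

Lemma eq_act_eq p w x : (act p w == act p x) = (w == x).
Proof. exact: inj_eq (@act_inj p) w x. Qed.

(** * The kernel of $\psi_n$ on a single level *)

Lemma on_level_delta x j : size x = j -> on_level j (fun w => w == x).
Proof. by move=> xj w; apply: contraNF => /eqP->; rewrite xj. Qed.

(** An even set of exchanges is the sum of the pairs [d x] over its points [x], the copies of
    [zeros j] cancelling. Each pair comes from one exchange at [zeros j], balanced on so low a
    level, and the translation by [x]. *)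
Lemma low_level_kernel j p : j.+1 < l -> on_level j p -> xsum j p = false ->
  portrait_perm p \in [~: G, G]%g.
Proof.
move=> jl pj p0; pose d x w := (w == zeros j) (+) (w == x).
have dj x : size x = j -> on_level j (d x).
  by move=> xj; apply: on_levelD; apply: on_level_delta; rewrite ?size_nseq.
have dC x : size x = j -> portrait_perm (d x) \in [~: G, G]%g.
  move=> xj; rewrite (@eq_portrait_perm _
    (fun w => (w == zeros j) (+) (act (translation x) w == zeros j))).
    apply: (@portrait_perm_commutator j (fun w => w == zeros j)).
    - by apply: on_level_delta; rewrite size_nseq.
    - by move=> w jw; rewrite /translation nth_default ?xj.
    - move=> w; apply: xsum0 => v vl; apply: (@on_level_delta _ j).
        by rewrite size_nseq.
      by rewrite size_cat vl; lia.
    - exact: balanced_translation.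
  move=> w _; rewrite /d; congr addb.
  have := act_translation x [::]; rewrite !cats0 xj => <-.
  by rewrite eq_act_eq.
have [sj sC] := portrait_perm_xsum p dj dC.
rewrite (eq_portrait_perm (q := fun w => xsum j (fun x => p x && d x w))) // => w _.
apply/esym; have [wj|wj] := eqVneq (size w) j; last by rewrite sj ?pj.
rewrite -[RHS](xsum_delta p wj).
under eq_xsum do rewrite /d andb_addr; rewrite xsumD -[RHS]addFb; congr addb.
by under eq_xsum do rewrite andbC; rewrite xsumZ p0 andbF.
Qed.

Lemma forkC y w b :
  fork y w = (w == y ++ b :: zeros l.-2) (+) (w == y ++ ~~ b :: zeros l.-2).
Proof. by case: b; rewrite // addbC. Qed.

Lemma size_fork y b : size (y ++ b :: zeros l.-2) = size y + l.-1.
Proof.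
by rewrite size_cat /= size_nseq; case: (l) l_ge2 => [|[]].
Qed.

Lemma on_level_fork y : on_level (size y + l.-1) (fork y).
Proof. by apply: on_levelD; apply: on_level_delta; apply: size_fork. Qed.

Lemma fork_translation y :
  portrait_perm (fun w => fork (zeros (size y)) w (+) fork y w) \in [~: G, G]%g.
Proof.
rewrite (@eq_portrait_perm _ (fun w => fork (zeros (size y)) w (+)
  fork (zeros (size y)) (act (translation y) w))).
  apply: (@portrait_perm_commutator (size y + l.-1)).
  - by rewrite -{1}(size_nseq (size y) false); apply: on_level_fork.
  - by move=> w yw; rewrite /translation nth_default // (leq_trans _ yw) ?leq_addr.
  - exact: balanced_fork.
  - exact: balanced_translation.
by move=> w _; congr addb; rewrite /fork -!act_translation !eq_act_eq.
Qed.

(** The half translation moves the exchange of the fork over [b] and fixes the one over [~~ b],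
    which cancels in the sum. *)
Lemma half_fork_translation y b s : size s = l.-2 ->
  portrait_perm (fun w => (w == y ++ b :: zeros l.-2) (+) (w == y ++ b :: s))
    \in [~: G, G]%g.
Proof.
move=> sl; pose g := half_translation (size y) b s.
rewrite (@eq_portrait_perm _ (fun w => fork y w (+) fork y (act g w))).
  apply: (@portrait_perm_commutator (size y + l.-1)).
  - exact: on_level_fork.
  - move=> w yw; rewrite /g /half_translation [nth false _ _]nth_default ?andbF //.
    by rewrite sl; lia.
  - exact: balanced_fork.
  - exact: balanced_half_translation.
move=> w _.
have -> : fork y (act g w) = (w == y ++ b :: s) (+) (w == y ++ ~~ b :: zeros l.-2).
  have /esym E1 := act_half_translation b s b s (erefl (size y)).
  have /esym E2 := act_half_translation b s (~~ b) (zeros l.-2) (erefl (size y)).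
  have := act_translation s [::]; rewrite !cats0 sl => actz.
  rewrite eqxx actz in E1; rewrite ifN in E2; last by case: (b).
  by rewrite (forkC y _ b) E1 [in LHS]E2 !eq_act_eq.
by rewrite (forkC y _ b) addbACA addbb addbF.
Qed.

(** First slide every exchange, by some [d x], to the zero tail of its own half. Half parities
    remain; by balance they form forks, which the [f y] move to the fork over zeros, where their
    total is even. *)
Lemma high_level_kernel j p : l <= j.+1 -> on_level j p -> balanced p ->
    xsum (j.+1 - l) (fun y => half_parity p (rcons y false)) = false ->
  portrait_perm p \in [~: G, G]%g.
Proof.
move=> lj pj pB p0; set r := j.+1 - l in p0; pose z := zeros l.-2.
have jE : j = r.+1 + l.-2 by rewrite /r; lia.
have jE' : j = r + l.-1 by rewrite /r; lia.
pose d x w := (w == take r.+1 x ++ z) (+) (w == x).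
pose f y w := fork (zeros (size y)) w (+) fork y w.
have dj x : size x = j -> on_level j (d x).
  move=> xj; apply: on_levelD; apply: on_level_delta => //.
  by rewrite size_cat size_nseq size_takel ?xj // jE leq_addr.
have dC x : size x = j -> portrait_perm (d x) \in [~: G, G]%g.
  move=> xj; rewrite /d -{2}(cat_take_drop r.+1 x).
  have : size (take r.+1 x) = r.+1 by rewrite size_takel // xj jE leq_addr.
  case/lastP: (take r.+1 x) => // y b; rewrite !cat_rcons => _; apply: half_fork_translation.
  by rewrite size_drop xj jE addKn.
have fj y : size y = r -> on_level j (f y).
  move=> yr; rewrite jE' -yr; apply: on_levelD; last exact: on_level_fork.
  by rewrite -{1}(size_nseq (size y) false); apply: on_level_fork.
have fC y : size y = r -> portrait_perm (f y) \in [~: G, G]%g.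
  by move=> _; apply: fork_translation.
have [Dj DC] := portrait_perm_xsum p dj dC.
have [Fj FC] := portrait_perm_xsum (fun y => half_parity p (rcons y false)) fj fC.
have := groupM DC FC; rewrite -(portrait_permD Dj Fj).
set q := fun w => _; suff qE w : q w = p w.
  by rewrite (eq_portrait_perm (q := p)) // => w _; apply: qE.
rewrite /q; have [wj|wj] := eqVneq (size w) j; last by rewrite Dj ?Fj ?pj.
rewrite -[RHS](xsum_delta p wj) -[RHS]addFb.
under eq_xsum do rewrite /d andb_addr.
under [X in _ (+) X]eq_xsum => y yr do rewrite /f yr andb_addr [in X in X (+) _]andbC.
rewrite !xsumD xsumZ p0 andbF addFb addbAC; congr addb.
(* What is left to cancel: the exchanges collected at zero tails against the forks. At [y ++ b :: t]
   both vanish unless [t] is zero, and then both are the half parity above [y]. *)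
have [y [b [t [yr tl wE]]]] :
    exists y b t, [/\ size y = r, size t = l.-2 & w = y ++ b :: t].
  exists (take r w), (nth false w r), (drop r.+1 w).
  rewrite size_takel ?size_drop; last by rewrite wj jE; lia.
  by rewrite wj jE addKn -drop_nth ?cat_take_drop // wj jE; lia.
rewrite jE xsum_cat.
have -> : xsum r.+1 (fun u => xsum l.-2 (fun v =>
    p (u ++ v) && (w == take r.+1 (u ++ v) ++ z))) =
    half_parity p (rcons y b) && (t == z).
  rewrite -(@xsum_delta r.+1 (rcons y b) (fun u => half_parity p u && (t == z)));
    last by rewrite size_rcons yr.
  apply: eq_xsum => u ur; under eq_xsum => v vl do rewrite take_size_cat // andbC.
  rewrite xsumZ andbC -andbA; congr andb.
  by rewrite wE -cat_rcons eqseq_cat ?size_rcons ?yr // andbC.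
have -> : xsum r (fun y' => half_parity p (rcons y' false) && fork y' w) =
    half_parity p (rcons y false) && (t == z).
  rewrite -(@xsum_delta r y
    (fun y' => half_parity p (rcons y' false) && (t == z))) //.
  by apply: eq_xsum => u ur; rewrite wE fork_cat // -andbA [(_ == z) && _]andbC.
by rewrite balanced_half_parity // addbb.
Qed.

Lemma level_kernel j p : on_level j p -> balanced p -> psi_exponent p j = false ->
  portrait_perm p \in [~: G, G]%g.
Proof.
rewrite /psi_exponent => pj pB; case: ltnP => jl.
  exact: low_level_kernel.
exact: high_level_kernel.
Qed.

(** * Peeling the kernel level by level *)

Lemma psi_kernel_portrait j p : j <= n -> balanced p ->
    (forall i, i < n -> psi_exponent p i = false) ->
    (forall w, size w < j -> p w = false) ->
  portrait_perm p \in [~: G, G]%g.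
Proof.
move=> /subnK; move: (n - j) => k; elim: k j p => [|k IHk] j p.
  by rewrite add0n => -> _ _ p0; rewrite portrait_perm1 ?group1.
rewrite addSnnS => kj pB pe p0.
have jn : j < n by rewrite -kj leq_addl.
(* Split off the lowest level on which [p] may be nonzero. *)
pose v w := (size w == j) && p w.
have vj : on_level j v by move=> w /negPf; rewrite /v => ->.
have vB : balanced v.
  move=> w; rewrite -[RHS](andbF (size w + l.-1 == j)) -(pB w) -xsumZ.
  by apply: eq_xsum => u ul; rewrite /v size_cat ul.
have ve i : i < n -> psi_exponent v i = false.
  move=> lin; have [->|ij] := eqVneq i j.
    by rewrite -(pe _ jn); apply: eq_psi_exponent => w wj; rewrite /v wj eqxx.
  rewrite -[RHS](psi_exponent_section xpred0 i); apply: eq_psi_exponent => w wi.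
  by rewrite /v wi (negPf ij).
have vC := level_kernel vj vB (ve _ jn).
have : ((portrait_perm v)^-1 * portrait_perm p)%g \in G.
  by rewrite groupM ?groupV ?portrait_perm_in.
case/M_portrait => q qB qE.
have pE : portrait_perm p = (portrait_perm v * portrait_perm q)%g.
  by rewrite -qE mulKVg.
have pvq w : size w < n -> p w = portrait_mul v q w.
  by apply: portrait_perm_inj; rewrite portrait_permM.
rewrite pE groupM // (IHk j.+1) // => [i lin | w wj].
  have := pe i lin; rewrite (@eq_psi_exponent p (portrait_mul v q)).
    by rewrite psi_exponentM // ve.
  by move=> w wi; rewrite pvq ?wi.
(* The cocycle rule gives [q] at images under [act v]; evaluating it at the preimage of [w] shows
   that [q] also vanishes on level [j]. *)
have wn : size (act_inv v w) = size w by rewrite -(size_act v) act_invK.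
have := @pvq (act_inv v w); rewrite wn (leq_trans wj) // /portrait_mul act_invK.
move=> /(_ isT); rewrite /v wn; move: wj; rewrite ltnS leq_eqVlt.
case/orP => [-> /= /esym/eqP | wj].
  by rewrite -{2}[p _]addbF (inj_eq (@addbI _)) => /eqP.
by rewrite p0 ?wn // andbF.
Qed.

Lemma psi_kernel s : s \in G -> psi L l s = 1%g -> s \in [~: G, G]%g.
Proof.
case/M_portrait => p pB -> p1; apply: (@psi_kernel_portrait 0) => // i lin.
apply: pm1_sign_inj; rewrite -(psi_portrait (Ordinal lin) pB) p1.
by rewrite ffunE.
Qed.

End Portraits.

Theorem theorem5p5 (L : labeling) (l n : nat) (hl : 2 <= l) :
  (exists f : {morphism M L l n >-> {dffun forall i : 'I_n, pm1}},
     [/\ {in M L l n, f =1 psi L l (n := n)},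
         (f @* M L l n = [set: {dffun forall i : 'I_n, pm1}])%g &
         ('ker f = [~: M L l n, M L l n])%g]) /\
  (M L l n / [~: M L l n, M L l n] \isog
     [set: {dffun forall i : 'I_n, pm1}])%g.
Proof.
pose f := Morphism (psiM (L := L) (n := n) hl).
have fT : (f @* M L l n = [set: {dffun forall i : 'I_n, pm1}])%g.
  apply/setP => e; rewrite inE; have [s sM <-] := psi_surjective L hl e.
  exact: (mem_morphim f).
have kerf : ('ker f = [~: M L l n, M L l n])%g.
  apply/eqP; rewrite eqEsubset; apply/andP; split; apply/subsetP => s.
    by case/morphpreP => sM /set1P; apply: psi_kernel.
  apply: subsetP s; rewrite gen_subG; apply/subsetP => _ /imset2P[s t sM tM ->].
  apply/kerP; first exact: groupR.
  rewrite morphR //; apply/eqP/commgP/ffunP => i; rewrite !ffunE; exact: mulgC_pm1.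
split; first by exists f.
by rewrite -kerf -fT; apply: first_isog.
Qed.
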